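(* Let $I=\{0,1,i_2,i_3,i_4\}$ with integers $1<i_2<i_3<i_4$ (so $k=3$, $m=5$). Then the ideal $\mathcal I_I^{\mathcal A}\subset\mathbb C[x_1,x_2,x_3]$ is generated by the three complete symmetric polynomials $h_{i_2-2},h_{i_3-2},h_{i_4-2}$, and $Vd^{\mathcal A}_{3;I}\subset\mathbb C^3$ has the expected codimension (equal to $3$) if and only if $\mathbb C[x_1,x_2,x_3]/\langle h_{i_2-2},h_{i_3-2},h_{i_4-2}\rangle$ is a complete intersection, in other words, if and only if $h_{i_2-2},h_{i_3-2},h_{i_4-2}$ is a regular sequence.
   Context: For a sequence $J=(0\le j_1<j_2<j_3)$ of integers, the associated Schur polynomial is $S_J(x_1,x_2,x_3)=\det\big(x_b^{j_a}\big)_{1\le a,b\le 3}/W(x_1,x_2,x_3)$, where $W(x_1,x_2,x_3)=\det\big(x_b^{a-1}\big)_{1\le a,b\le 3}$. The ideal $\mathcal I_I^{\mathcal A}\subset\mathbb C[x_1,x_2,x_3]$ is generated by the ten Schur polynomials $S_J$, where $J$ runs over all length-$3$ subsequences of $I$, and $Vd^{\mathcal A}_{3;I}\subset\mathbb C^3$ is the variety it defines. $h_i$ denotes the complete symmetric polynomial of degree $i$ in $x_1,x_2,x_3$ ($h_0=1$). Here ''complete intersection'' means that the three listed generators form a regular sequence (in particular the ideal is proper). *)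

(* Defs.v *)
From mathcomp Require Import all_boot all_order all_algebra.
From mathcomp Require Import ring.
From mathcomp Require Import boolp classical_sets reals.
From mathcomp Require Import complex mpoly.

Set Implicit Arguments.
Unset Strict Implicit.
Unset Printing Implicit Defensive.

Import GRing.Theory.
Local Open Scope classical_set_scope.
Local Open Scope ring_scope.

Section Ideals.
Context {A : comNzRingType}.

Definition ideal_gen (G : set A) : set A :=
  [set p | exists (n : nat) (c g : 'I_n -> A),
     (forall i, G (g i)) /\ p = \sum_(i < n) c i * g i].

(* Each entry is a nonzerodivisor modulo the ideal generated by the previous
   ones, and the ideal generated by all of them is proper. *)
Definition regular_sequence (s : seq A) : Prop :=
  (forall i, (i < size s)%N -> forall p : A,
     ideal_gen [set` take i s] (p * s`_i) -> ideal_gen [set` take i s] p)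
  /\ ~ ideal_gen [set` s] 1.

End Ideals.

Section Zariski.
Context {F : fieldType} {n : nat}.

Definition zero_locus (G : set {mpoly F[n]}) : set ('I_n -> F) :=
  [set v | forall p, G p -> p.@[v] = 0].

Definition zclosed (Z : set ('I_n -> F)) : Prop :=
  exists G : set {mpoly F[n]}, Z = zero_locus G.

Definition zirreducible (Z : set ('I_n -> F)) : Prop :=
  Z !=set0 /\
  forall X Y, zclosed X -> zclosed Y -> Z `<=` X `|` Y -> Z `<=` X \/ Z `<=` Y.

(* A chain Z_0 < Z_1 < ... < Z_d of irreducible closed subsets of V; since V
   will be closed, being closed in V or in the affine space is the same. *)
Definition has_irr_chain (V : set ('I_n -> F)) (d : nat) : Prop :=
  exists Z : nat -> set ('I_n -> F),
    (forall i, (i <= d)%N -> [/\ zclosed (Z i), zirreducible (Z i) & Z i `<=` V])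
    /\ (forall i, (i < d)%N -> Z i `<` Z i.+1).

(* Dimension of the Zariski topology on V. The empty set has no dimension, hence no codimension. *)
Definition has_dim (V : set ('I_n -> F)) (d : nat) : Prop :=
  has_irr_chain V d /\ forall e, has_irr_chain V e -> (e <= d)%N.

(* Codimension in the n-dimensional affine space: n - dim V. *)
Definition has_codim (V : set ('I_n -> F)) (c : nat) : Prop :=
  exists2 d, has_dim V d & (d + c)%N = n.

End Zariski.

Definition complete_sym {R : comNzRingType} (n d : nat) : {mpoly R[n]} :=
  \sum_(m : 'X_{1..n < d.+1} | mdeg m == d) 'X_[m].

Section Det3.
Context {A : comNzRingType}.

Lemma det3E (m : nat -> nat -> A) :
  \det (\matrix_(i < 3, j < 3) m i j) =
    m 0%N 0%N * (m 1%N 1%N * m 2%N 2%N - m 2%N 1%N * m 1%N 2%N)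
  - m 1%N 0%N * (m 0%N 1%N * m 2%N 2%N - m 2%N 1%N * m 0%N 2%N)
  + m 2%N 0%N * (m 0%N 1%N * m 1%N 2%N - m 1%N 1%N * m 0%N 2%N).
Proof.
rewrite (expand_det_col _ ord0) !big_ord_recl big_ord0 /cofactor.
rewrite !(expand_det_col _ ord0) !big_ord_recl !big_ord0 /cofactor !det_mx11.
rewrite !mxE /= /bump /= !(add0n, addn0, addn1, add1n) !expr0 !expr1.
rewrite (_ : (-1) ^+ 2 = 1 :> A); last by rewrite sqrrN expr1n.
move: (m 0%N 0%N) (m 0%N 1%N) (m 0%N 2%N) (m 1%N 0%N) (m 1%N 1%N) (m 1%N 2%N)
  (m 2%N 0%N) (m 2%N 1%N) (m 2%N 2%N) => a b c d e f g h i.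
ring.
Qed.

Lemma divided_differences (x y z : A) n : exists u v w,
  [/\ x ^+ n = y ^+ n + (x - y) * u, z ^+ n = y ^+ n + (z - y) * v
    & u = v + (x - z) * w].
Proof.
elim: n => [|n [u [v [w [Ex Ez Eu]]]]].
  by exists 0, 0, 0; rewrite !expr0 !mulr0 !addr0.
exists (y ^+ n + x * u), (y ^+ n + z * v), (v + x * w).
rewrite !exprS Ex Ez Eu; move: (y ^+ n) => t; split; ring.
Qed.

Lemma alternant_dvd (x : nat -> A) (j : nat -> nat) : exists s,
  s * \det (\matrix_(a < 3, b < 3) x b ^+ a)
    = \det (\matrix_(a < 3, b < 3) x b ^+ j a).
Proof.
rewrite (det3E (fun a b => x b ^+ a)) (det3E (fun a b => x b ^+ j a)).
move: (x 0%N) (x 1%N) (x 2%N) => {x} x y z.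
have [u0 [v0 [w0 [Ex0 Ez0 Eu0]]]] := divided_differences x y z (j 0%N).
have [u1 [v1 [w1 [Ex1 Ez1 Eu1]]]] := divided_differences x y z (j 1%N).
have [u2 [v2 [w2 [Ex2 Ez2 Eu2]]]] := divided_differences x y z (j 2%N).
exists (y ^+ j 0%N * (v1 * w2 - v2 * w1) - y ^+ j 1%N * (v0 * w2 - v2 * w0)
  + y ^+ j 2%N * (v0 * w1 - v1 * w0)).
rewrite Ex0 Ex1 Ex2 Ez0 Ez1 Ez2 Eu0 Eu1 Eu2.
move: (y ^+ j 0%N) (y ^+ j 1%N) (y ^+ j 2%N) => y0 y1 y2.
rewrite !expr0 !expr1 !expr2; ring.
Qed.

End Det3.

Section Schur.
Context {F : fieldType}.
Implicit Types J : 3.-tuple nat.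

Definition alternant J : {mpoly F[3]} :=
  \det (\matrix_(a < 3, b < 3) ('X_b : {mpoly F[3]}) ^+ tnth J a).

Definition vandermonde : {mpoly F[3]} :=
  \det (Vandermonde 3 (\row_(b < 3) ('X_b : {mpoly F[3]}))).

Lemma vandermonde_neq0 : vandermonde != 0.
Proof.
rewrite /vandermonde det_Vandermonde; apply/prodf_neq0 => i _.
apply/prodf_neq0 => j ij; rewrite !mxE subr_eq0; apply/eqP.
move=> /(congr1 (fun p : {mpoly F[3]} => p@_(U_(i)%MM))).
have ji : (j == i) = false by rewrite -val_eqE /= gtn_eqF.
by rewrite !mcoeffXU eqxx ji => /eqP; rewrite ?oner_eq0 // eq_sym oner_eq0.
Qed.

Lemma schur_exists J : exists s : {mpoly F[3]}, s * vandermonde == alternant J.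
Proof.
have [s sE] := alternant_dvd (fun b => 'X_(inord b) : {mpoly F[3]})
  (fun a => tnth J (inord a)).
exists s; apply/eqP; rewrite /alternant.
have -> : vandermonde = \det (\matrix_(a < 3, b < 3) ('X_(inord b) : {mpoly F[3]}) ^+ a).
  by congr (\det _); apply/matrixP => a b; rewrite !mxE inord_val.
by rewrite sE; congr (\det _); apply/matrixP => a b; rewrite !mxE !inord_val.
Qed.

(* The exact quotient S_J = alternant J / vandermonde, see schurP. *)
Definition schur J : {mpoly F[3]} := xchoose (schur_exists J).

Lemma schurP J (s : {mpoly F[3]}) :
  s * vandermonde = alternant J <-> s = schur J.
Proof.
have E : schur J * vandermonde = alternant J.
  exact/eqP/(xchooseP (schur_exists J)).
by rewrite -E; split=> [/(mulIf vandermonde_neq0)|->].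
Qed.

Definition schur_ideal (I : seq nat) : set {mpoly F[3]} :=
  ideal_gen [set s | exists2 J : 3.-tuple nat, subseq J I & s = schur J].

Definition Vd (I : seq nat) : set ('I_3 -> F) := zero_locus (schur_ideal I).

End Schur.

Arguments schur F J : clear implicits.
Arguments schur_ideal F I : clear implicits.
Arguments Vd F I : clear implicits.

(* Main.v *)
Require Import Defs.
From mathcomp Require Import all_boot all_order all_algebra.
From mathcomp Require Import boolp classical_sets cardinality reals.
From mathcomp Require Import finmap complex mpoly.
From mathcomp Require Import ring lra.

Set Implicit Arguments.
Unset Strict Implicit.
Unset Printing Implicit Defensive.

Import Order.TTheory GRing.Theory Num.Theory.
Local Open Scope classical_set_scope.
Local Open Scope ring_scope.

(* Modulo (X - x_1)(X - x_2)(X - x_3), the power X^j reduces to a_j + b_j X +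
   h_{j-2} X^2; hence S_J is the determinant with rows (a_j, b_j, h_{j-2}) for j
   in J. Expanding it along its last column puts S_J in the ideal of the h's,
   while S_{0,1,j} = h_{j-2}.

   The zero set V of the three forms h is a cone, and a cone through a nonzero
   point contains a line, so (unless h_0 = 1 occurs and V is empty) codimension 3
   means V = {0}.  If the forms are regular, they cannot all lie in the ideal of a
   line, which has two generators.  Conversely, if V = {0}, the Nullstellensatz
   puts powers of the three variables in the ideal; these powers are regular, so
   by the depth sensitivity of the Koszul complex all syzygies of the forms are
   Koszul, which for forms of positive degree is regularity. *)

(** * Ideals generated by few elements, regular sequences of length three and their syzygies *)

Section IdealTheory.
Context {A : comNzRingType}.
Implicit Types (G H : set A) (p q x y : A) (s : seq A).

Lemma ideal_gen0 G : ideal_gen G 0.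
Proof.
exists 0, (fun=> 0), (fun=> 0); split; first by case.
by rewrite big_ord0.
Qed.

Lemma ideal_gen_mem G p : G p -> ideal_gen G p.
Proof. by move=> Gp; exists 1, (fun=> 1), (fun=> p); rewrite big_ord1 mul1r. Qed.

Lemma ideal_genD G p q : ideal_gen G p -> ideal_gen G q -> ideal_gen G (p + q).
Proof.
move=> [n [c [g [Gg ->]]]] [m [d [h [Gh ->]]]].
pose j (T : Type) (a : 'I_n -> T) (b : 'I_m -> T) (k : 'I_(n + m)) :=
  match split k with inl i => a i | inr i => b i end.
exists (n + m)%N, (j _ c d), (j _ g h); split.
  by move=> k; rewrite /j; case: (split k).
rewrite big_split_ord /=; congr (_ + _); apply: eq_bigr => i _.
  by rewrite /j (unsplitK (inl i)).
by rewrite /j (unsplitK (inr i)).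
Qed.

Lemma ideal_genMl G p q : ideal_gen G q -> ideal_gen G (p * q).
Proof.
move=> [n [c [g [Gg ->]]]]; exists n, (fun i => p * c i), g; split=> //.
by rewrite mulr_sumr; apply: eq_bigr => i _; rewrite mulrA.
Qed.

Lemma ideal_genMr G p q : ideal_gen G p -> ideal_gen G (p * q).
Proof. by rewrite mulrC; apply: ideal_genMl. Qed.

Lemma ideal_genN G p : ideal_gen G p -> ideal_gen G (- p).
Proof. by rewrite -mulN1r; apply: ideal_genMl. Qed.

Lemma ideal_genB G p q : ideal_gen G p -> ideal_gen G q -> ideal_gen G (p - q).
Proof. by move=> Gp Gq; apply: ideal_genD => //; apply: ideal_genN. Qed.

Lemma ideal_gen_exprB G x y e :
  ideal_gen G (x - y) -> ideal_gen G (x ^+ e - y ^+ e).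
Proof. by move=> Gxy; rewrite subrXX; apply: ideal_genMr. Qed.

Lemma ideal_gen_sum G I (r : seq I) (P : pred I) (f : I -> A) :
  (forall i, P i -> ideal_gen G (f i)) -> ideal_gen G (\sum_(i <- r | P i) f i).
Proof. by move=> Gf; elim/big_ind: _ => //; [exact: ideal_gen0|exact: ideal_genD]. Qed.

Lemma ideal_gen_subset G H : G `<=` ideal_gen H -> ideal_gen G `<=` ideal_gen H.
Proof.
move=> GH p [n [c [g [Gg ->]]]]; apply: ideal_gen_sum => i _.
exact/ideal_genMl/GH.
Qed.

Lemma ideal_gen_setU1 G x p :
  ideal_gen (x |` G) p <-> exists q, ideal_gen G (p - q * x).
Proof.
split=> [[n [c [g [Gg ->]]]]|[q Gp]].
  elim/big_ind: _ => [|p1 p2 [q1 ?] [q2 ?]|i _].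
  - by exists 0; rewrite mul0r subr0; apply: ideal_gen0.
  - exists (q1 + q2); rewrite (_ : _ - _ = (p1 - q1 * x) + (p2 - q2 * x)).
      exact: ideal_genD.
    by ring.
  - case: (Gg i) => [->|Ggi]; first by exists (c i); rewrite subrr; apply: ideal_gen0.
    by exists 0; rewrite mul0r subr0; apply/ideal_genMl/ideal_gen_mem.
rewrite -[p](subrK (q * x)); apply: ideal_genD.
  by apply: ideal_gen_subset Gp => y Gy; apply: ideal_gen_mem; right.
by apply/ideal_genMl/ideal_gen_mem; left.
Qed.

Lemma ideal_gen_nil p : ideal_gen [set` [::]] p <-> p = 0.
Proof.
split=> [[n [c [g [Gg ->]]]]|->]; last exact: ideal_gen0.
by apply: big1 => i _; have := Gg i.
Qed.

Lemma ideal_gen_cons x s p :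
  ideal_gen [set` x :: s] p <-> exists q, ideal_gen [set` s] (p - q * x).
Proof.
rewrite -ideal_gen_setU1; suff -> : [set` x :: s] = x |` [set` s] by [].
apply/seteqP; split=> y /=; rewrite in_cons.
  by case/orP=> [/eqP|]; [left|right].
by case=> [->|->]; rewrite ?eqxx ?orbT.
Qed.

Lemma ideal_gen_seq1 x p : ideal_gen [set` [:: x]] p <-> exists a, p = a * x.
Proof.
rewrite ideal_gen_cons; split=> -[a].
  by move=> /ideal_gen_nil/subr0_eq ->; exists a.
by move=> ->; exists a; apply/ideal_gen_nil; rewrite subrr.
Qed.

Lemma ideal_gen_seq2 x y p :
  ideal_gen [set` [:: x; y]] p <-> exists a b, p = a * x + b * y.
Proof.
rewrite ideal_gen_cons; split=> -[a].
  by move=> /ideal_gen_seq1[b pE]; exists a, b; rewrite -pE addrC subrK.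
by move=> [b ->]; exists a; apply/ideal_gen_seq1; exists b; rewrite addrAC subrr add0r.
Qed.

Lemma ideal_gen_seq3 x y z p : ideal_gen [set` [:: x; y; z]] p <->
  exists a b c, p = a * x + b * y + c * z.
Proof.
rewrite ideal_gen_cons; split=> -[a].
  move=> /ideal_gen_seq2[b [c pE]]; exists a, b, c.
  by rewrite -addrA -pE addrC subrK.
move=> [b [c ->]]; exists a; apply/ideal_gen_seq2; exists b, c.
by rewrite -(addrA (a * x)) addrAC subrr add0r.
Qed.

Lemma regular_sequence3P x y z : regular_sequence [:: x; y; z] <->
  [/\ forall p, p * x = 0 -> p = 0,
      forall p a, p * y = a * x -> exists b, p = b * x,
      forall p a b, p * z = a * x + b * y -> exists c d, p = c * x + d * y
    & ~ exists a b c, 1 = a * x + b * y + c * z].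
Proof.
split=> [[reg prop]|[r0 r1 r2 prop]].
  split.
  - move=> p px; apply/ideal_gen_nil; apply: (reg 0%N) => //=.
    exact/ideal_gen_nil.
  - move=> p a E; apply/ideal_gen_seq1; apply: (reg 1%N) => //=.
    by apply/ideal_gen_seq1; exists a.
  - move=> p a b E; apply/ideal_gen_seq2; apply: (reg 2%N) => //=.
    by apply/ideal_gen_seq2; exists a, b.
  - by move=> H; apply/prop/ideal_gen_seq3.
split; last by move=> /ideal_gen_seq3.
case=> [|[|[|//]]] _ p /=.
- by move=> /ideal_gen_nil/r0 ->; apply: ideal_gen0.
- by move=> /ideal_gen_seq1[a /r1 E]; apply/ideal_gen_seq1.
- by move=> /ideal_gen_seq2[a [b /r2 E]]; apply/ideal_gen_seq2.
Qed.

(* Write f_i = a_i * x + b_i * y and D = a1 * b2 - a2 * b1.  The 2x2 minors of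
   the 3x2 matrix (a_i, b_i) give a relation D * f3 \in (f1, f2), so D lies in
   (f1, f2); Cramer's rule x * D = b2 * f1 - b1 * f2 together with the
   regularity of f1, f2 then puts 1 in (x, y). *)
Lemma regular_sequence3_sub_seq2 (f1 f2 f3 x y : A) :
  regular_sequence [:: f1; f2; f3] ->
  [set` [:: f1; f2; f3]] `<=` ideal_gen [set` [:: x; y]] ->
  ideal_gen [set` [:: x; y]] 1.
Proof.
move=> /regular_sequence3P[r0 r1 r2 _] sub.
have /ideal_gen_seq2[a1 [b1 E1]] := sub f1 (mem_head _ _).
have /ideal_gen_seq2[a2 [b2 E2]] : ideal_gen [set` [:: x; y]] f2.
  by apply: sub; rewrite /= !inE eqxx orbT.
have /ideal_gen_seq2[a3 [b3 E3]] : ideal_gen [set` [:: x; y]] f3.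
  by apply: sub; rewrite /= !inE eqxx !orbT.
have [c [d Dcd]] : exists c d, a1 * b2 - a2 * b1 = c * f1 + d * f2.
  apply: (r2 _ (a3 * b2 - a2 * b3) (a1 * b3 - a3 * b1)).
  by rewrite E1 E2 E3; ring.
have cancel_f1 p q : p * f1 = q * f1 -> p = q.
  by move=> E; apply/subr0_eq/r0; rewrite mulrBl E subrr.
have [r Er] : exists r, b1 + x * d = r * f1.
  apply: (r1 _ (b2 - x * c)); apply/subr0_eq.
  transitivity (x * (c * f1 + d * f2 - (a1 * b2 - a2 * b1))).
    by rewrite E1 E2; ring.
  by rewrite Dcd subrr mulr0.
have [t Et] : exists t, a1 - y * d = t * f1.
  apply: (r1 _ (a2 + y * c)); apply/subr0_eq.
  transitivity (- y * (c * f1 + d * f2 - (a1 * b2 - a2 * b1))).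
    by rewrite E1 E2; ring.
  by rewrite Dcd subrr mulr0.
apply/ideal_gen_seq2; exists t, r; apply: cancel_f1.
transitivity (x * (t * f1) + y * (r * f1)); last by ring.
by rewrite -Er -Et mul1r {1}E1; ring.
Qed.

(* The vector u is a Koszul 1-cycle of f, and multiplication by g_i = m_i . f is
   null-homotopic on the Koszul complex of f, with homotopy the exterior product
   with m_i. Lifting successively through g1, g2, g3 gives w. *)
Lemma koszul_syzygy (f1 f2 f3 g1 g2 g3 u1 u2 u3 : A) :
  regular_sequence [:: g1; g2; g3] ->
  [set` [:: g1; g2; g3]] `<=` ideal_gen [set` [:: f1; f2; f3]] ->
  u1 * f1 + u2 * f2 + u3 * f3 = 0 ->
  exists w1 w2 w3, [/\ u1 = w3 * f2 - w2 * f3, u2 = w1 * f3 - w3 * f1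
    & u3 = w2 * f1 - w1 * f2].
Proof.
move=> /regular_sequence3P[r0 r1 r2 _] sub uf.
have /ideal_gen_seq3[a1 [a2 [a3 Ea]]] := sub g1 (mem_head _ _).
have /ideal_gen_seq3[b1 [b2 [b3 Eb]]] : ideal_gen [set` [:: f1; f2; f3]] g2.
  by apply: sub; rewrite /= !inE eqxx orbT.
have /ideal_gen_seq3[c1 [c2 [c3 Ec]]] : ideal_gen [set` [:: f1; f2; f3]] g3.
  by apply: sub; rewrite /= !inE eqxx !orbT.
have cancel_g1 p q : g1 * p = g1 * q -> p = q.
  by move=> E; apply/subr0_eq/r0; rewrite mulrC mulrBr E subrr.
pose v1 := u2 * a3 - u3 * a2; pose v2 := u3 * a1 - u1 * a3.
pose v3 := u1 * a2 - u2 * a1.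
have V1 : g1 * u1 = v3 * f2 - v2 * f3.
  transitivity (v3 * f2 - v2 * f3 + a1 * (u1 * f1 + u2 * f2 + u3 * f3)).
    by rewrite Ea /v2 /v3; ring.
  by rewrite uf mulr0 addr0.
have V2 : g1 * u2 = v1 * f3 - v3 * f1.
  transitivity (v1 * f3 - v3 * f1 + a2 * (u1 * f1 + u2 * f2 + u3 * f3)).
    by rewrite Ea /v1 /v3; ring.
  by rewrite uf mulr0 addr0.
have V3 : g1 * u3 = v2 * f1 - v1 * f2.
  transitivity (v2 * f1 - v1 * f2 + a3 * (u1 * f1 + u2 * f2 + u3 * f3)).
    by rewrite Ea /v1 /v2; ring.
  by rewrite uf mulr0 addr0.
(* With [v] the exterior product of [u] and [a], [z] is the 3-vector obtained from [b] and [v]; its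
   Koszul boundary is [g2 * v] minus [g1] times the exterior product of [u] and [b]. Contracting
   [W1], [W2], [W3] with [c] therefore gives [g3 * z] in [(g1, g2)]. *)
pose z := b1 * v1 + b2 * v2 + b3 * v3.
have W1 : z * f1 = g2 * v1 - g1 * (u2 * b3 - u3 * b2).
  transitivity (g2 * v1 - (g1 * u2) * b3 + (g1 * u3) * b2); last by ring.
  by rewrite V2 V3 Eb /z; ring.
have W2 : z * f2 = g2 * v2 - g1 * (u3 * b1 - u1 * b3).
  transitivity (g2 * v2 - (g1 * u3) * b1 + (g1 * u1) * b3); last by ring.
  by rewrite V1 V3 Eb /z; ring.
have W3 : z * f3 = g2 * v3 - g1 * (u1 * b2 - u2 * b1).
  transitivity (g2 * v3 - (g1 * u1) * b2 + (g1 * u2) * b1); last by ring.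
  by rewrite V1 V2 Eb /z; ring.
have [z1 [z2 Ez]] : exists z1 z2, z = z1 * g1 + z2 * g2.
  apply: (r2 _ (- (c1 * (u2 * b3 - u3 * b2) + c2 * (u3 * b1 - u1 * b3)
                   + c3 * (u1 * b2 - u2 * b1))) (c1 * v1 + c2 * v2 + c3 * v3)).
  rewrite Ec.
  transitivity (c1 * (z * f1) + c2 * (z * f2) + c3 * (z * f3)); first by ring.
  by rewrite W1 W2 W3; ring.
(* Subtracting [z2 * f] from [v] makes it divisible by [g1] and leaves its boundary unchanged, so
   the quotients [w] have boundary [u]. *)
have lift v f t : z * f = g2 * v - g1 * t -> exists w, v - z2 * f = w * g1.
  move=> W; apply: (r1 _ (t + z1 * f)).
  apply/subr0_eq; transitivity (g2 * v - g1 * t - (z1 * g1 + z2 * g2) * f).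
    by ring.
  by rewrite -Ez W subrr.
have [w1 L1] := lift _ _ _ W1; have [w2 L2] := lift _ _ _ W2.
have [w3 L3] := lift _ _ _ W3.
exists w1, w2, w3; split; apply: cancel_g1.
- transitivity ((w3 * g1) * f2 - (w2 * g1) * f3); last by ring.
  by rewrite -L2 -L3 V1; ring.
- transitivity ((w1 * g1) * f3 - (w3 * g1) * f1); last by ring.
  by rewrite -L1 -L3 V2; ring.
- transitivity ((w2 * g1) * f1 - (w1 * g1) * f2); last by ring.
  by rewrite -L1 -L2 V3; ring.
Qed.

End IdealTheory.

(** * Substitution modulo an ideal, and homogeneous components *)

Section MpolyIdeals.
Context {F : fieldType} {n : nat}.
Implicit Types (G : set {mpoly F[n]}) (p q r : {mpoly F[n]}) (m k : 'X_{1..n}).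

Lemma mpoly_monomial_division k p : exists q r, p = q * 'X_[k] + r /\
  forall m, r@_m = if (k <= m)%MM then 0 else p@_m.
Proof.
exists (\sum_(m <- msupp p | (k <= m)%MM) p@_m *: 'X_[m - k]).
exists (\sum_(m <- msupp p | ~~ (k <= m)%MM) p@_m *: 'X_[m]); split.
  rewrite {1}[p]mpolyE (bigID (fun m => (k <= m)%MM)) /=; congr (_ + _).
  rewrite mulr_suml; apply: eq_bigr => m km.
  by rewrite -scalerAl -mpolyXD submK.
move=> m; rewrite raddf_sum /=.
under eq_bigr do rewrite mcoeffZ mcoeffX.
case: ifPn => km.
  rewrite big1 // => m' km'; case: eqP => [E|]; last by rewrite mulr0.
  by rewrite E km in km'.
rewrite [in RHS](mpolyE p) raddf_sum /= [RHS](bigID (fun m => ~~ (k <= m)%MM)) /=.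
rewrite [X in _ = _ + X]big1 ?addr0.
  by apply: eq_bigr => m' _; rewrite mcoeffZ mcoeffX.
move=> m'; rewrite negbK mcoeffZ mcoeffX => km'.
case: eqP => [E|]; last by rewrite mulr0.
by rewrite -E km' in km.
Qed.

Lemma mcoeffMX_eq0 p k m : ~~ (k <= m)%MM -> (p * 'X_[k])@_m = 0.
Proof.
move=> km; apply/memN_msupp_eq0; apply: contra km.
by rewrite (perm_mem (msuppMX _ _)) => /mapP[m' _ ->]; apply: lem_addr.
Qed.

(** The sum is [p] with [c i] substituted for ['X_i]. Congruences modulo [G] pass to powers,
    products and linear combinations. *)
Lemma ideal_gen_mmapB G (c : 'I_n -> {mpoly F[n]}) p :
  (forall i, ideal_gen G ('X_i - c i)) ->
  ideal_gen G (p - \sum_(m <- msupp p) p@_m *: \prod_i c i ^+ m i).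
Proof.
move=> Gc; rewrite {1}[p]mpolyE -sumrB; apply: ideal_gen_sum => m _.
rewrite -scalerBr -mul_mpolyC; apply: ideal_genMl; rewrite mpolyXE_id.
elim/big_rec2: _ => [|i q2 q1 _ Gq]; first by rewrite subrr; apply: ideal_gen0.
rewrite (_ : _ - _ = ('X_i ^+ m i - c i ^+ m i) * q2 + c i ^+ m i * (q2 - q1)).
  apply: ideal_genD; last exact: ideal_genMl.
  exact/ideal_genMr/ideal_gen_exprB.
by ring.
Qed.

Lemma ideal_gen_mevalB G (a : 'I_n -> F) p :
  (forall i, ideal_gen G ('X_i - (a i)%:MP)) ->
  ideal_gen G (p - (p.@[a])%:MP).
Proof.
move=> /(ideal_gen_mmapB p).
suff -> : (p.@[a])%:MP_[n] = \sum_(m <- msupp p) p@_m *: \prod_i (a i)%:MP ^+ m i by [].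
rewrite mevalE raddf_sum /=; apply: eq_bigr => m _.
rewrite mpolyCM -mul_mpolyC rmorph_prod; congr (_ * _).
by apply: eq_bigr => i _; rewrite rmorphXn.
Qed.

(** Replacing each variable by a multiple of ['X_k] turns every monomial of degree [d] into a
    multiple of ['X_k ^+ d]. *)
Lemma ideal_gen_homogB G (a : 'I_n -> F) (k : 'I_n) d p :
  p \is d.-homog -> (forall i, ideal_gen G ('X_i - a i *: 'X_k)) ->
  ideal_gen G (p - p.@[a] *: 'X_k ^+ d).
Proof.
move=> /dhomogP hp /(ideal_gen_mmapB p).
suff -> : p.@[a] *: 'X_k ^+ d =
    \sum_(m <- msupp p) p@_m *: \prod_i (a i *: 'X_k) ^+ m i by [].
rewrite mevalE scaler_suml; apply: eq_big_seq => m /hp dm.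
rewrite -scalerA; congr (_ *: _).
under [RHS]eq_bigr do rewrite exprZn -mul_mpolyC.
rewrite big_split /= -mul_mpolyC rmorph_prod; congr (_ * _).
by rewrite -dm /= mdegE expr_sum.
Qed.

Lemma meval_homogZ d p (t : F) (v : 'I_n -> F) :
  p \is d.-homog -> p.@[fun i => t * v i] = t ^+ d * p.@[v].
Proof.
move=> /dhomogP hp; rewrite !mevalE mulr_sumr; apply: eq_big_seq => m /hp dm.
rewrite mulrCA; congr (_ * _); under eq_bigr do rewrite exprMn.
by rewrite big_split /= -dm /= mdegE expr_sum.
Qed.

Lemma pihomogM_homog d e p q : p \is d.-homog ->
  pihomog mdeg e (p * q) = if (d <= e)%N then p * pihomog mdeg (e - d) q else 0.
Proof.
move=> hp; rewrite {1}(pihomog_partitionE (leqnn (mmeasure mdeg q))).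
rewrite mulr_sumr raddf_sum /=.
have E i : pihomog mdeg e (p * pihomog mdeg i q) =
    if (d + i == e)%N then p * pihomog mdeg i q else 0.
  have hpq := dhomogM hp (pihomogP mdeg i q).
  by case: eqP => [<-|/eqP ne]; [rewrite pihomog_dE|rewrite (pihomog_ne0 ne)].
under eq_bigr do rewrite E.
case: leqP => de; last first.
  by rewrite big1 // => i _; rewrite gtn_eqF // ltn_addr.
have deE i : (d + i == e)%N = (i == e - d)%N.
  by rewrite -{1}(subnKC de) eqn_add2l.
under eq_bigr do rewrite deE.
rewrite -big_mkcond /=; case: (ltnP (e - d) (mmeasure mdeg q)) => eq.
  by rewrite (big_pred1 (Ordinal eq)).
(* The sum over the components of [q] is empty here; the component of degree [e - d] is 0 as well,
   since it lies beyond the degree of [q]. *)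
rewrite big_pred0; last by move=> i; rewrite ltn_eqF // (leq_trans _ eq).
rewrite pihomogE big_seq_cond big_pred0 ?mulr0 // => m.
apply/negbTE/negP => /andP[/mmeasure_mnm_lt mq /eqP dm].
have : (mdeg m < e - d)%N := leq_trans (mq mdeg) eq.
by rewrite -dm ltnn.
Qed.

Lemma ideal_gen_pihomog G p e :
  (forall f, G f -> exists d, f \is d.-homog) ->
  ideal_gen G p -> ideal_gen G (pihomog mdeg e p).
Proof.
move=> hG [k [c [g [Gg ->]]]]; rewrite raddf_sum; apply: ideal_gen_sum => i _ /=.
have [d hd] := hG _ (Gg i); rewrite mulrC (pihomogM_homog _ _ hd).
by case: ifP => _; [apply/ideal_genMr/ideal_gen_mem|apply: ideal_gen0].
Qed.

End MpolyIdeals.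

(** * Powers of the variables, and regularity from Koszul syzygies *)

Section RegularPowers.
Context {F : fieldType}.

(** Divide by the earlier powers and look at a monomial left in the remainder: it is divisible by
    none of them. Shifting it by a power of the next variable keeps its earlier exponents, so its
    shifted coefficient vanishes in every element of the ideal of the earlier powers. *)
Lemma regular_sequence_powers (a b c : nat) : (0 < a)%N -> (0 < b)%N -> (0 < c)%N ->
  regular_sequence [:: 'X_(inord 0) ^+ a; 'X_(inord 1) ^+ b; 'X_(inord 2) ^+ c
                     : {mpoly F[3]}].
Proof.
move=> a0 b0 c0; rewrite !mpolyXn.
have leU (i : 'I_3) (e : nat) (m : 'X_{1..3}) : ((U_(i) *+ e)%MM <= m)%MM = (e <= m i)%N.
  apply/mnm_lepP/idP => [/(_ i)|em j]; first by rewrite mulmnE mnm1E eqxx mul1n.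
  by rewrite mulmnE mnm1E; case: eqP => [<-|]; rewrite ?mul1n // mul0n.
have ne (i j : nat) (m : 'X_{1..3}) e : (i < 3)%N -> (j < 3)%N -> i != j ->
    (U_(inord j) *+ e + m)%MM (inord i) = m (inord i).
  move=> i3 j3 ij; rewrite mnmDE mulmnE mnm1E -val_eqE /= !inordK //.
  by rewrite eq_sym (negbTE ij) mul0n.
apply/regular_sequence3P; split.
- by move=> p /eqP; rewrite mulf_eq0 -[X in _ || X]msize_poly_eq0 msizeX orbF => /eqP.
- move=> p q E; have [s [r [pE rE]]] := mpoly_monomial_division (U_(inord 0) *+ a)%MM p.
  suff r0 : r = 0 by exists s; rewrite pE r0 addr0.
  apply/mpolyP => m; rewrite rE mcoeff0; case: ifP => // /negbT ma.
  rewrite -(mcoeffMX _ (U_(inord 1) *+ b)%MM) E mcoeffMX_eq0 //.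
  by rewrite leU ne // -leU.
- move=> p q q' E; have [s [r [pE rE]]] := mpoly_monomial_division (U_(inord 0) *+ a)%MM p.
  have [s' [r' [rE' r'E]]] := mpoly_monomial_division (U_(inord 1) *+ b)%MM r.
  suff r0 : r' = 0 by exists s, s'; rewrite pE rE' r0 addr0.
  apply/mpolyP => m; rewrite r'E mcoeff0; case: ifP => // /negbT mb.
  rewrite rE; case: ifP => // /negbT ma.
  rewrite -(mcoeffMX _ (U_(inord 2) *+ c)%MM) E mcoeffD.
  by rewrite !mcoeffMX_eq0 ?addr0 // leU ne // -leU.
- move=> [u [v [w]]] /(congr1 (meval (fun=> 0))).
  have z (i : 'I_3) e : (0 < e)%N -> ('X_[F, (U_(i) *+ e)]).@[fun=> 0] = 0.
    by move=> e0; rewrite -mpolyXn rmorphXn /= mevalXU expr0n gtn_eqF.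
  rewrite meval1 !mevalD !mevalM !z // !mulr0 !addr0 => /eqP.
  by rewrite oner_eq0.
Qed.

End RegularPowers.

(* If p * f2 lies in (f1), the Koszul form of this syzygy writes p as w * f3
   modulo f1 with w * f2 again in (f1); since f3 has positive degree, one
   concludes by induction on the degree of p. *)
Lemma regular_sequence3_of_koszul (F : fieldType) (n : nat)
    (f1 f2 f3 : {mpoly F[n]}) (d1 d2 d3 : nat) :
  f1 \is d1.-homog -> f2 \is d2.-homog -> f3 \is d3.-homog -> (0 < d3)%N ->
  ~ ideal_gen [set` [:: f1; f2; f3]] 1 ->
  (forall u1 u2 u3, u1 * f1 + u2 * f2 + u3 * f3 = 0 ->
    exists w1 w2 w3, [/\ u1 = w3 * f2 - w2 * f3, u2 = w1 * f3 - w3 * f1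
      & u3 = w2 * f1 - w1 * f2]) ->
  regular_sequence [:: f1; f2; f3].
Proof.
move=> h1 h2 h3 d3_gt0 prop koszul.
have comp p e : ideal_gen [set` [:: f1]] (p * f2) ->
    ideal_gen [set` [:: f1]] (pihomog mdeg e p * f2).
  move=> pf2; rewrite (_ : _ * f2 = pihomog mdeg (d2 + e) (p * f2)).
    by apply: ideal_gen_pihomog => // f; rewrite /= inE => /eqP ->; exists d1.
  by rewrite mulrC [p * f2]mulrC (pihomogM_homog _ _ h2) leq_addr addKn.
have homog_case e p : p \is e.-homog -> ideal_gen [set` [:: f1]] (p * f2) ->
    ideal_gen [set` [:: f1]] p.
  elim/ltn_ind: e p => e IH p hp /ideal_gen_seq1[q E].
  have [w1 [w2 [w3 [_ pE w12]]]] : exists w1 w2 w3, [/\ - q = w3 * f2 - w2 * f3,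
      p = w1 * f3 - w3 * f1 & 0 = w2 * f1 - w1 * f2].
    by apply: koszul; rewrite E; ring.
  rewrite -(pihomog_dE hp) pE pihomogB; apply: ideal_genB; last first.
    apply: ideal_gen_pihomog; last by apply/ideal_gen_seq1; exists w3.
    by move=> f; rewrite /= inE => /eqP ->; exists d1.
  rewrite mulrC (pihomogM_homog _ _ h3); case: leqP => de; last exact: ideal_gen0.
  apply: ideal_genMl; apply: (IH (e - d3)%N).
  - by rewrite ltn_subrL d3_gt0 (leq_trans d3_gt0).
  - exact: pihomogP.
  - apply: comp; apply/ideal_gen_seq1; exists w2.
    by apply/esym/subr0_eq; rewrite -w12.
apply/regular_sequence3P; split.
(* If [f1 = 0], then (1, 0, 0) is a syzygy, and its Koszul form puts 1 in the ideal. *)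
- move=> p /eqP; rewrite mulf_eq0 => /orP[/eqP //|/eqP f10]; case: prop.
  have [|w1 [w2 [w3 [E _ _]]]] := koszul 1 0 0.
    by rewrite f10 !(mulr0, mul0r) !addr0.
  by apply/ideal_gen_seq3; exists 0, w3, (- w2); rewrite E; ring.
- move=> p q E; apply/ideal_gen_seq1.
  rewrite (pihomog_partitionE (leqnn (mmeasure mdeg p))).
  apply: ideal_gen_sum => i _; apply: homog_case (pihomogP _ _ _) _.
  by apply: comp; apply/ideal_gen_seq1; exists q.
- move=> p a b E.
  have [|w1 [w2 [w3 [_ _ pE]]]] := koszul (- a) (- b) p.
    by rewrite E; ring.
  by exists w2, (- w1); rewrite pE mulNr.
- by move=> H; apply/prop/ideal_gen_seq3.
Qed.

(** * The Nullstellensatz over an uncountable algebraically closed field *)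

Lemma horner_algZ (R : comNzRingType) (A : algType R) (x : A) c p :
  horner_alg x (c *: p) = c *: horner_alg x p.
Proof. by rewrite -mul_polyC rmorphM /= horner_algC mulr_algl. Qed.

Section Nullstellensatz.
Context {F : closedFieldType} {n : nat}.
Context (uncountableF : ~ countable [set: F]).
Implicit Types (G : set {mpoly F[n]}).

(** The coefficient matrix has more rows than columns, hence a nonzero left kernel vector. *)
Lemma mpoly_linear_dependence (I : finType) s (Q : I -> {mpoly F[n]}) :
  (forall i, msize (Q i) <= s)%N -> (#|{: 'X_{1..n < s}}| < #|I|)%N ->
  exists2 c : I -> F, (exists i, c i != 0) & \sum_i c i *: Q i = 0.
Proof.
move=> Qs cardI.
pose M := \matrix_(i < #|I|, j < #|{: 'X_{1..n < s}}|)
  (Q (enum_val i))@_(enum_val j : 'X_{1..n < s}).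
have /rowV0Pn[c /sub_kermxP cM c0] : kermx M != 0.
  by rewrite kermx_eq0 /row_free neq_ltn (leq_ltn_trans (rank_leq_col M)).
exists (fun i => c 0 (enum_rank i)).
  have /rV0Pn[j cj] := c0; by exists (enum_val j); rewrite enum_valK.
apply/mpolyP => m; rewrite raddf_sum /= mcoeff0.
under eq_bigr do rewrite mcoeffZ.
case: (ltnP (mdeg m) s) => ms; last first.
  apply: big1 => i _; rewrite [_@_m]memN_msupp_eq0 ?mulr0 //.
  by apply: msize_mdeg_ge; apply: leq_trans ms.
have /rowP/(_ (enum_rank (BMultinom ms))) := cM; rewrite !mxE => E.
rewrite -[RHS]E (reindex (@enum_val I I)) /=; last exact/onW_bij/enum_val_bij.
by apply: eq_bigr => j _; rewrite !mxE enum_valK enum_rankK.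
Qed.

(* Were X_i - a invertible modulo G for every a, with inverse Q a, uncountability
   of F would give a linear relation between finitely many of the Q a; clearing
   denominators, it becomes a nonzero polynomial in X_i that lies in (G). *)
Lemma nullstellensatz_step G (i : 'I_n) : ~ ideal_gen G 1 ->
  exists a, ~ ideal_gen (('X_i - a%:MP) |` G) 1.
Proof.
move=> G1; apply: contrapT => noa.
have {noa} /choice[Q GQ] a : exists q, ideal_gen G (1 - q * ('X_i - a%:MP)).
  by apply/ideal_gen_setU1; apply: contrapT => Ga; apply: noa; exists a.
(* Such a [p] splits into linear factors, each invertible modulo [G]; cancelling them one at a time
   leaves 1 in the ideal. *)
suff [p p0 Gp] : exists2 p : {poly F}, p != 0 & ideal_gen G (horner_alg 'X_i p).
  have [r pE] := closed_field_poly_normal p.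
  suff : ideal_gen G (\prod_(z <- r) ('X_i - z%:MP)).
    elim: r {pE} => [|z r IH]; first by rewrite big_nil.
    rewrite big_cons => Gzr; apply: IH; set t := \prod_(_ <- r) _ in Gzr *.
    rewrite (_ : t = t * (1 - Q z * ('X_i - z%:MP)) + Q z * (('X_i - z%:MP) * t)).
      by apply: ideal_genD; apply: ideal_genMl.
    by ring.
  have -> : \prod_(z <- r) ('X_i - z%:MP) = (lead_coef p)^-1%:MP * horner_alg 'X_i p.
    rewrite {2}pE horner_algZ mul_mpolyC scalerA mulVf ?lead_coef_eq0 // scale1r.
    rewrite rmorph_prod; apply: eq_bigr => z _.
    by rewrite rmorphB /= horner_algX horner_algC -mul_mpolyC mulr1.
  exact: ideal_genMl.
(* [F] is the union over [s] of these sets; if all were finite, [F] would be countable. *)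
have [s infs] : exists s, infinite_set [set a | (msize (Q a) <= s)%N].
  apply: contrapT => fin; apply: uncountableF.
  have -> : [set: F] = \bigcup_(s in [set: nat]) [set a | (msize (Q a) <= s)%N].
    by apply/seteqP; split=> // a _; exists (msize (Q a)) => /=.
  apply: bigcup_countable => // s _; apply: finite_set_countable.
  by apply: contrapT => infs; apply: fin; exists s.
have [B Bs cardB] := infinite_set_fset #|{: 'X_{1..n < s}}|.+1 infs.
have [c [j0 cj0] cQ] : exists2 c : B -> F, (exists j, c j != 0)
    & \sum_j c j *: Q (val j) = 0.
  apply: (@mpoly_linear_dependence _ s); last by rewrite -cardfE.
  by move=> j; apply: (Bs (val j)); apply: valP.
(* [T j] is the product of all denominators but the one of [j]. At [j0] every other [T j] vanishes,
   so the combination is nonzero. *)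
pose T (j : B) : {poly F} := \prod_(l | l != j) ('X - (val l)%:P).
exists (\sum_j c j *: T j).
  apply/eqP => /(congr1 (horner^~ (val j0))); rewrite horner0 horner_sum.
  rewrite (bigD1 j0) //= big1 ?addr0 => [|j jj0].
    apply/eqP; rewrite hornerZ mulf_neq0 // horner_prod prodf_seq_neq0.
    apply/allP => l _; apply/implyP => lj0.
    by rewrite hornerXsubC subr_eq0 (inj_eq val_inj) eq_sym.
  rewrite hornerZ horner_prod (bigD1 j0) 1?eq_sym //=.
  by rewrite hornerXsubC subrr mul0r mulr0.
pose L (j : B) : {mpoly F[n]} := 'X_i - (val j)%:MP.
have -> : horner_alg 'X_i (\sum_j c j *: T j) =
    \sum_j c j *: \prod_(l | l != j) L l * (1 - Q (val j) * L j).
  transitivity (\sum_j c j *: \prod_(l | l != j) L l).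
    rewrite rmorph_sum; apply: eq_bigr => j _; rewrite /= horner_algZ rmorph_prod.
    congr (_ *: _); apply: eq_bigr => l _.
    by rewrite rmorphB /= horner_algX horner_algC -mul_mpolyC mulr1.
  apply/eqP; rewrite -subr_eq0 -sumrB.
  rewrite (eq_bigr (fun j => (\prod_l L l) * (c j *: Q (val j)))).
    by rewrite -mulr_sumr cQ mulr0.
  move=> j _; rewrite [\prod_l L l](bigD1 j) //= -!mul_mpolyC -/(L j); ring.
by apply: ideal_gen_sum => j _; apply: ideal_genMl.
Qed.

(** Adjoin some ['X_i - a i] for each variable in turn, keeping the ideal proper. Modulo the
    resulting ideal every [p] in [G] is the constant [p.@[a]], which must then be 0. *)
Lemma weak_nullstellensatz G : ~ ideal_gen G 1 -> zero_locus G !=set0.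
Proof.
move=> G1.
have [H [GH H1 HX]] : exists H, [/\ G `<=` H, ~ ideal_gen H 1
    & forall i, i \in enum 'I_n -> exists a, ideal_gen H ('X_i - a%:MP)].
  elim: (enum 'I_n) => [|i s [H [GH H1 HX]]]; first by exists G; split.
  have [a Ha] := nullstellensatz_step i H1.
  exists (('X_i - a%:MP) |` H); split=> [p Gp|//|].
    by right; apply: GH.
  move=> j; rewrite inE => /orP[/eqP ->|/HX[b Hb]].
    by exists a; apply: ideal_gen_mem; left.
  exists b; apply: ideal_gen_subset Hb => p Hp.
  by apply: ideal_gen_mem; right.
have /choice[a Ha] (i : 'I_n) := HX i (mem_enum _ _).
exists a => p /GH/ideal_gen_mem Hp; apply: contrapT => /eqP pa.
apply: H1; rewrite -mpolyC1 -(mulVf pa) mpolyCM; apply: ideal_genMl.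
rewrite -[X in ideal_gen _ X](subKr p); apply: ideal_genB => //.
exact: ideal_gen_mevalB.
Qed.

(* The homogeneous components of 1 = r + q * ('X_k - 1) with r \in (G) give
   q_e = - 'X_k ^+ e modulo (G) for every e, and q_e = 0 for large e. *)
Lemma projective_nullstellensatz G (k : 'I_n) :
  (forall f, G f -> exists d, f \is d.-homog) ->
  zero_locus G `<=` [set v | v k = 0] ->
  exists N, ideal_gen G ('X_k ^+ N).
Proof.
move=> hG Gk.
(* A zero of [G] has [v k = 0], so [G] and ['X_k - 1] have no common zero. *)
have [q] : exists q, ideal_gen G (1 - q * ('X_k - 1%:MP)).
  apply/ideal_gen_setU1; apply: contrapT => /weak_nullstellensatz[v Gv].
  have /eqP : v k - 1 = 0.
    by rewrite -(Gv ('X_k - 1%:MP)) ?mevalB ?mevalXU ?mevalC //; left.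
  rewrite (Gk v) ?sub0r ?oppr_eq0 ?oner_eq0 // => p Gp.
  by apply: Gv; right.
rewrite mpolyC1 => Gq.
have hX : ('X_k : {mpoly F[n]}) \is 1.-homog by rewrite dhomogX /= mdeg1.
have Ge e : ideal_gen G (pihomog mdeg e q + 'X_k ^+ e).
  elim: e => [|e IH].
    have := ideal_gen_pihomog 0 hG Gq.
    rewrite mulrBr mulr1 [q * _]mulrC !pihomogB (pihomogM_homog _ _ hX) /=.
    by rewrite (pihomog_dE (dhomog1 _ _)) sub0r opprK addrC expr0.
  have := ideal_gen_pihomog e.+1 hG Gq.
  rewrite mulrBr mulr1 [q * _]mulrC !pihomogB (pihomogM_homog _ _ hX) /= subn1 /=.
  rewrite (pihomog_ne0 _ (dhomog1 _ _)) // => Gr.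
  rewrite exprS (_ : _ + _ = (0 - ('X_k * pihomog mdeg e q - pihomog mdeg e.+1 q))
     + 'X_k * (pihomog mdeg e q + 'X_k ^+ e)); last by ring.
  by apply: ideal_genD => //; apply: ideal_genMl.
exists (mmeasure mdeg q).
have := Ge (mmeasure mdeg q); rewrite pihomogE big_seq_cond big_pred0 ?add0r //.
move=> m; apply/negbTE/negP => /andP[/mmeasure_mnm_lt mq /eqP dm].
by have := mq mdeg; rewrite -dm ltnn.
Qed.

End Nullstellensatz.

(** * Regularity of three forms that vanish together only at the origin *)

Lemma meval0_homog (F : fieldType) n d (p : {mpoly F[n]}) (v : 'I_n -> F) :
  p \is d.-homog -> (0 < d)%N -> (forall i, v i = 0) -> p.@[v] = 0.
Proof.
move=> hp d0 v0.
have := meval_homogZ 0 v hp; rewrite expr0n gtn_eqF // mul0r => <-.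
by apply: meval_eq => i; rewrite mul0r v0.
Qed.

Lemma regular_sequence3_of_zero_locus (F : closedFieldType)
    (f1 f2 f3 : {mpoly F[3]}) (d1 d2 d3 : nat) :
  ~ countable [set: F] ->
  f1 \is d1.-homog -> f2 \is d2.-homog -> f3 \is d3.-homog ->
  (0 < d1)%N -> (0 < d2)%N -> (0 < d3)%N ->
  zero_locus [set` [:: f1; f2; f3]] `<=` [set v | forall i, v i = 0] ->
  regular_sequence [:: f1; f2; f3].
Proof.
move=> uncF h1 h2 h3 d1_gt0 d2_gt0 d3_gt0 V0.
have prop : ~ ideal_gen [set` [:: f1; f2; f3]] 1.
  move=> /ideal_gen_seq3[a [b [c /(congr1 (meval (fun=> 0)))]]].
  rewrite meval1 !mevalD !mevalM (meval0_homog h1) // (meval0_homog h2) //.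
  by rewrite (meval0_homog h3) // !mulr0 !addr0 => /eqP; rewrite oner_eq0.
have pow (k : 'I_3) : exists2 N, (0 < N)%N & ideal_gen [set` [:: f1; f2; f3]] ('X_k ^+ N).
  (* The exponent 0 would put 1 in the ideal, against [prop]. *)
  have [||[|N] GN] := @projective_nullstellensatz _ _ uncF [set` [:: f1; f2; f3]] k.
  - move=> f; rewrite /= !inE => /or3P[] /eqP ->.
    + by exists d1.
    + by exists d2.
    + by exists d3.
  - by move=> v /V0 v0; apply: v0.
  - by rewrite expr0 in GN.
  - by exists N.+1.
have [a a0 Ga] := pow (inord 0); have [b b0 Gb] := pow (inord 1).
have [c c0 Gc] := pow (inord 2).
apply: (regular_sequence3_of_koszul h1 h2 h3) => // u1 u2 u3.
apply: (koszul_syzygy (regular_sequence_powers a0 b0 c0)) => p.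
by rewrite /= !inE => /or3P[] /eqP ->.
Qed.

(** * Uncountability of the real and complex numbers, by Cantor's nested intervals *)

Lemma realType_uncountable (R : realType) : ~ countable [set: R].
Proof.
move=> /countable_injP[f f_inj].
(* [g] is a left inverse of the supposed injection [f], with value 0 off its range. *)
pose g n := xget 0 [set x : R | f x = n].
have gf x : g (f x) = x.
  apply: f_inj; rewrite ?in_setT // /g.
  by case: xgetP => [y _ //|/(_ x) []].
(* Nested closed intervals [I n], the interval of index n.+1 avoiding g n. *)
pose step n (I : R * R) := if g n <= (I.1 + I.2) / 2
  then (((I.1 + I.2) / 2 + I.2) / 2, I.2) else (I.1, (I.1 + I.2) / 2).
pose I := fix I n : R * R := if n is m.+1 then step m (I m) else (0, 1).
have I_lt n : (I n).1 < (I n).2.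
  by elim: n => [|n IH] /=; [exact: ltr01|rewrite /step; case: ifP => _ /=; lra].
have I_step n : (I n).1 <= (I n.+1).1 /\ (I n.+1).2 <= (I n).2.
  by have := I_lt n; rewrite /= /step; case: ifP => _ /=; lra.
have I1_le m n : (m <= n)%N -> (I m).1 <= (I n).1.
  by move=> /subnK <-; elim: (n - m)%N => //= k IH; apply: le_trans IH (I_step _).1.
have I2_le m n : (m <= n)%N -> (I n).2 <= (I m).2.
  by move=> /subnK <-; elim: (n - m)%N => //= k IH; apply: le_trans (I_step _).2 IH.
have I12 m n : (I m).1 <= (I n).2.
  apply: (le_trans (I1_le _ _ (leq_maxl m n))).
  exact: le_trans (ltW (I_lt _)) (I2_le _ _ (leq_maxr m n)).
pose s := sup (range (fun n => (I n).1)).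
have s_ge n : (I n).1 <= s.
  by apply: ub_le_sup; [exists (I 0%N).2 => _ [m _ <-]|exists n].
have s_le n : s <= (I n).2.
  by apply: ge_sup => [|_ [m _ <-]]; [exists (I 0%N).1, 0%N|].
(* The interval of index [(f s).+1] contains [s] but avoids [g (f s)], which is [s]. *)
have := s_ge (f s).+1; have := s_le (f s).+1; have := I_lt (f s).
by rewrite /= /step gf; case: ifP => /=; lra.
Qed.

Lemma complex_uncountable (R : realType) : ~ countable [set: R[i]].
Proof.
move=> /countable_injP[f f_inj]; apply: (@realType_uncountable R).
apply/countable_injP; exists (fun x => f x%:C%C) => x y _ _ E.
by have [] : x%:C%C = y%:C%C by apply: f_inj; rewrite ?in_setT.
Qed.

(** * Zero sets of ideals and of regular forms *)

Lemma zero_locus_ideal_gen (F : fieldType) n (G : set {mpoly F[n]}) :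
  zero_locus (ideal_gen G) = zero_locus G.
Proof.
apply/seteqP; split=> v vG p; first by move=> /ideal_gen_mem/vG.
move=> [k [c [g [Gg ->]]]]; rewrite raddf_sum /= big1 // => i _.
by rewrite mevalM (vG _ (Gg i)) mulr0.
Qed.

(* The common zeros form a cone; a nonzero v on it puts the three polynomials in
   the ideal of the line through v, which is generated by two linear forms. *)
Lemma zero_locus_of_regular_sequence3 (F : fieldType)
    (f1 f2 f3 : {mpoly F[3]}) (d1 d2 d3 : nat) :
  f1 \is d1.-homog -> f2 \is d2.-homog -> f3 \is d3.-homog ->
  regular_sequence [:: f1; f2; f3] ->
  zero_locus [set` [:: f1; f2; f3]] `<=` [set v | forall i, v i = 0].
Proof.
move=> h1 h2 h3 reg v Vv k; apply: contrapT => /eqP vk.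
(* [i] and [j] are the two indices other than [k]; below, [a k = 1] makes [L k] zero, so [L i] and
   [L j] generate all the [L l]. *)
have [i [j ijk]] : exists i j : 'I_3, forall l, l \in [:: i; j; k].
  exists (ordS k), (ordS (ordS k)) => l; rewrite !inE -!val_eqE {vk}.
  by case: k => [[|[|[|//]]] ?]; case: l => [[|[|[|//]]] ?].
pose a l := (v k)^-1 * v l.
pose L l : {mpoly F[3]} := 'X_l - a l *: 'X_k.
have GL l : ideal_gen [set` [:: L i; L j]] (L l).
  have := ijk l; rewrite !inE => /or3P[] /eqP ->.
  - by apply: ideal_gen_mem; rewrite /= inE eqxx.
  - by apply: ideal_gen_mem; rewrite /= !inE eqxx orbT.
  - by rewrite /L /a mulVf // scale1r subrr; apply: ideal_gen0.
have Gf f d : f \is d.-homog -> f \in [:: f1; f2; f3] ->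
    ideal_gen [set` [:: L i; L j]] f.
  move=> hf /Vv fv; have := ideal_gen_homogB hf GL.
  by rewrite (meval_homogZ _ _ hf) fv mulr0 scale0r subr0.
have : ideal_gen [set` [:: L i; L j]] 1.
  apply: (regular_sequence3_sub_seq2 reg) => f ff.
  have := ff; rewrite /= !inE => /or3P[] /eqP E; rewrite E in ff *.
  - exact: Gf h1 ff.
  - exact: Gf h2 ff.
  - exact: Gf h3 ff.
move=> /ideal_gen_seq2[p [q /(congr1 (meval v))]].
have Lv l : (L l).@[v] = 0.
  by rewrite mevalB mevalZ !mevalXU /a mulrAC mulVf // mul1r subrr.
by rewrite meval1 mevalD !mevalM !Lv !mulr0 addr0 => /eqP; rewrite oner_eq0.
Qed.

(** * Dimension of cones, and codimension 3 *)

Section Cones.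
Context {F : closedFieldType} {n : nat}.
Implicit Types (v w : 'I_n -> F) (V : set ('I_n -> F)).

Lemma zclosed1 v : zclosed [set v].
Proof.
exists [set p | exists i, p = 'X_i - (v i)%:MP]; apply/seteqP; split.
  by move=> _ -> _ [i ->]; rewrite mevalB mevalXU mevalC subrr.
move=> w Vw; apply/funext => i; apply/subr0_eq.
by rewrite -(Vw ('X_i - (v i)%:MP)) ?mevalB ?mevalXU ?mevalC //; exists i.
Qed.

Lemma zirreducible1 v : zirreducible [set v].
Proof.
split=> [|X Y _ _ sub]; first by exists v.
by have [Xv|Yv] := sub v erefl; [left|right] => _ ->.
Qed.

Definition line v : set ('I_n -> F) := range (fun t i => t * v i).

Lemma zclosed_line v k : v k != 0 -> zclosed (line v).
Proof.
move=> vk; exists [set p | exists i, p = v k *: 'X_i - v i *: 'X_k].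
apply/seteqP; split=> [_ [t _ <-] _ [i ->]|w Vw].
  by rewrite mevalB !mevalZ !mevalXU; ring.
exists (w k / v k) => //; apply/funext => i.
have := Vw _ (ex_intro _ i erefl); rewrite mevalB !mevalZ !mevalXU.
by move=> /subr0_eq E; rewrite mulrAC [w k * _]mulrC -E mulrAC divff // mul1r.
Qed.

Lemma meval_line v (p : {mpoly F[n]}) :
  exists P : {poly F}, forall t, P.[t] = p.@[fun i => t * v i].
Proof.
exists (mmap polyC (fun i => v i *: 'X) p) => t.
rewrite mevalE /mmap horner_sum; apply: eq_bigr => m _.
rewrite hornerM hornerC /mmap1 horner_prod; congr (_ * _).
by apply: eq_bigr => i _; rewrite horner_exp hornerZ hornerX mulrC.
Qed.

(** If neither closed set contains the line, each has an equation restricting to a nonzero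
    polynomial in [t]. Their product has a non-root, which gives a point of the line outside both
    sets. *)
Lemma zirreducible_line v : zirreducible (line v).
Proof.
split; first by exists (fun i => 0 * v i), 0.
have witness G : ~ (line v `<=` zero_locus G) -> exists p (P : {poly F}),
    [/\ G p, P != 0 & forall t, P.[t] = p.@[fun i => t * v i]].
  move=> /existsNP[w /not_implyP[[t _ <-]]] /existsNP[p /not_implyP[Gp /eqP pt]].
  have [P PE] := meval_line v p; exists p, P; split=> //.
  by apply: contraNneq pt => P0; rewrite -PE P0 horner0.
move=> _ _ [GX ->] [GY ->] sub; apply: contrapT => /not_orP[/witness[p [P [Gp P0 PE]]]].
move=> /witness[q [Q [Gq Q0 QE]]].
have /closed_nonrootP[t] : P * Q != 0 by rewrite mulf_neq0.
rewrite /root hornerM mulf_eq0 negb_or PE QE => /andP[pt qt].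
have [|/(_ p Gp)/eqP|/(_ q Gq)/eqP] := sub (fun i => t * v i).
- by exists t.
- by rewrite (negbTE pt).
- by rewrite (negbTE qt).
Qed.

(** Dimension 0 makes [V] nonempty, so scaling by 0 gives the origin. A further point [w] would give
    the chain from the origin to [line w], of length 1. *)
Lemma has_dim0_coneP V : (forall v t, V v -> V (fun i => t * v i)) ->
  has_dim V 0 <-> V = [set fun=> 0].
Proof.
move=> cone; split=> [[[Z [HZ _]] dim0]|->]; last first.
  split; first by exists (fun=> [set fun=> 0]); split=> // i _;
    split=> //; [exact: zclosed1|exact: zirreducible1].
  case=> // d [Z [HZ Zlt]].
  have [_ [[v Zv] _] Z0] := HZ 0%N isT; have [_ _ Z1] := HZ 1%N isT.
  have [_ ] := Zlt 0%N isT; case=> w /Z1 ->.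
  by rewrite -(Z0 v Zv).
have [_ [[v Zv] _] ZV] := HZ 0%N isT.
have V0 : V (fun=> 0).
  by rewrite (_ : (fun=> 0) = fun i => 0 * v i); [exact/cone/ZV|apply/funext=> i; rewrite mul0r].
apply/seteqP; split=> [w Vw|_ -> //]; apply: contrapT => w0.
have [k wk] : exists k, w k != 0.
  apply: contrapT => H; apply: w0; apply/funext => k.
  by apply/eqP/negPn/negP => wk; apply: H; exists k.
suff /dim0 : has_irr_chain V 1 by [].
exists (fun i => if i is 0%N then [set fun=> 0] else line w); split.
  case=> [|[|//]] _; split; [exact: zclosed1|exact: zirreducible1|by move=> _ ->| | |].
  - exact: zclosed_line wk.
  - exact: zirreducible_line.
  - by move=> _ [t _ <-]; apply: cone.
case=> // _; split.
  by move=> _ ->; exists 0 => //; apply/funext => i; rewrite mul0r.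
move=> /(_ w) /= H; apply: w0; apply: H; exists 1 => //.
by apply/funext => i; rewrite mul1r.
Qed.

End Cones.

Lemma has_codim3_regular (F : closedFieldType)
    (f1 f2 f3 : {mpoly F[3]}) (d1 d2 d3 : nat) :
  ~ countable [set: F] ->
  f1 \is d1.-homog -> f2 \is d2.-homog -> f3 \is d3.-homog ->
  (0 < d1)%N -> (0 < d2)%N -> (0 < d3)%N ->
  has_codim (zero_locus [set` [:: f1; f2; f3]]) 3 <->
  regular_sequence [:: f1; f2; f3].
Proof.
move=> uncF h1 h2 h3 d1_gt0 d2_gt0 d3_gt0; set V := zero_locus _.
have memV v : V v <-> [/\ f1.@[v] = 0, f2.@[v] = 0 & f3.@[v] = 0].
  split=> [Vv|[v1 v2 v3] p]; first by split; apply: Vv; rewrite /= !inE eqxx ?orbT.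
  by rewrite /= !inE => /or3P[] /eqP ->.
have cone v t : V v -> V (fun i => t * v i).
  move=> /memV[v1 v2 v3]; apply/memV.
  rewrite (meval_homogZ _ _ h1) (meval_homogZ _ _ h2) (meval_homogZ _ _ h3).
  by rewrite v1 v2 v3 !mulr0.
have codimE : has_codim V 3 <-> has_dim V 0.
  split=> [[[|d] dimV]|]; [by []|by rewrite addnC|by exists 0%N].
rewrite codimE (has_dim0_coneP cone); split=> [V0|reg].
  apply: (regular_sequence3_of_zero_locus uncF h1 h2 h3) => // v.
  by rewrite -/V V0 => -> i.
apply/seteqP; split=> [v /(zero_locus_of_regular_sequence3 h1 h2 h3 reg) v0|_ ->].
  exact/funext.
by apply/memV; rewrite (meval0_homog h1) // (meval0_homog h2) // (meval0_homog h3).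
Qed.

(** * Complete symmetric polynomials and Schur polynomials in three variables *)

Lemma mcoeff_complete_sym (R : comNzRingType) n d m :
  (complete_sym n d : {mpoly R[n]})@_m = (mdeg m == d)%:R.
Proof.
rewrite raddf_sum /=; under eq_bigr do rewrite mcoeffX.
case: (eqVneq (mdeg m) d) => [dm|dm].
  have m_lt : (mdeg m < d.+1)%N by rewrite dm.
  rewrite (bigD1 (BMultinom m_lt)) /= ?dm // eqxx big1 ?addr0 // => k /andP[_ km].
  by rewrite (_ : _ == m = false) //; apply: contraNF km => /eqP kE; apply/eqP/val_inj.
rewrite big1 // => k /eqP kd; case: eqP => // km.
by rewrite -km kd eqxx in dm.
Qed.

Lemma complete_sym0 (R : comNzRingType) n : complete_sym n 0 = 1 :> {mpoly R[n]}.
Proof. by apply/mpolyP => m; rewrite mcoeff_complete_sym mcoeff1 mdeg_eq0. Qed.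

Lemma complete_sym_homog (R : comNzRingType) n d :
  (complete_sym n d : {mpoly R[n]}) \is d.-homog.
Proof. by apply: rpred_sum => m /eqP dm; rewrite dhomogX /= dm. Qed.

Section CompleteSym3.
Context {F : fieldType}.
Implicit Types (J : 3.-tuple nat).

(* [h_{j-2}], read as 0 for j < 2: with this shift the recurrence below holds
   from j = 0 on. *)
Definition shifted_sym j : {mpoly F[3]} := if (1 < j)%N then complete_sym 3 (j - 2) else 0.

Let x (b : nat) : {mpoly F[3]} := 'X_(inord b).
Let e1 := x 0 + x 1 + x 2.
Let e2 := x 0 * x 1 + x 0 * x 2 + x 1 * x 2.
Let e3 := x 0 * x 1 * x 2.

(** Adding 2 on the left avoids truncated subtraction and covers [j < 2] too: there the equality
    fails whenever [k] divides [m]. *)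
Lemma mcoeff_shifted_symMX j k m :
  (shifted_sym j * 'X_[k])@_m = ((k <= m)%MM && (mdeg m + 2 == j + mdeg k)%N)%:R.
Proof.
case: (boolP (k <= m)%MM) => [km|km] /=; last by rewrite mcoeffMX_eq0.
rewrite -{1}(submK km) addmC mcoeffMX -{2}(submK km) mdegD addnAC eqn_add2r.
rewrite /shifted_sym; case: ltnP => j2.
  by rewrite mcoeff_complete_sym -{2}(subnK j2) eqn_add2r.
by rewrite mcoeff0 addn2 gtn_eqF // ltnS (leq_trans j2).
Qed.

(** At a monomial [m] all four terms carry the same degree condition, [mdeg m = j + 1]. What remains
    is inclusion-exclusion over the variables dividing [m]; it needs [m] nonzero, which the degree
    condition ensures. *)
Lemma shifted_sym_rec j : shifted_sym j.+3 =
  e1 * shifted_sym j.+2 - e2 * shifted_sym j.+1 + e3 * shifted_sym j.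
Proof.
rewrite /e1 /e2 /e3 /x -!mpolyXD ![_ * shifted_sym _]mulrC -[LHS]mulr1 -mpolyX0.
rewrite !mulrDr; apply/mpolyP => m.
rewrite !(mcoeffD, mcoeffN) !mcoeff_shifted_symMX !mdegD !mdeg1 mdeg0 addn0.
have leD (i : 'I_3) (k : 'X_{1..3}) : (k i = 0)%N ->
    ((k + U_(i))%MM <= m)%MM = (k <= m)%MM && (0 < m i)%N.
  move=> ki; apply/mnm_lepP/andP => [H|[/mnm_lepP H mi] l'].
    split; last by have := H i; rewrite mnmDE ki mnm1E eqxx.
    by apply/mnm_lepP => l'; apply: leq_trans (H l'); rewrite mnmDE leq_addr.
  rewrite mnmDE mnm1E; case: eqP => [<-|_]; first by rewrite ki.
  by rewrite addn0.
have le1 (i : 'I_3) : (U_(i) <= m)%MM = (0 < m i)%N by rewrite lep1mP lt0n.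
have le0 : (0 <= m)%MM by apply/mnm_lepP => l; rewrite mnm0E.
have ne (i l : nat) : (i < 3)%N -> (l < 3)%N -> i != l ->
    (U_(inord i) : 'X_{1..3})%MM (inord l : 'I_3) = 0%N.
  by move=> i3 l3 il; rewrite mnm1E -val_eqE /= !inordK // (negbTE il).
rewrite !leD ?mnmDE ?ne // !le1 le0 /=.
have -> : mdeg m = (m (inord 0) + m (inord 1) + m (inord 2))%N.
  rewrite mdegE !big_ord_recl big_ord0 addn0 addnA.
  by congr (m _ + m _ + m _)%N; apply/val_inj; rewrite /= inordK.
move: (m (inord 0)) (m (inord 1)) (m (inord 2)) => [|a] [|b] [|c] /=;
  rewrite ?(addn0, add0n, addSn, addnS, eqSS) /=; ring.
Qed.

(** The coefficients of the remainder of X^j modulo the cubic whose roots are the three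
    variables. *)
Let coef j (c : nat) := match c with
  | 0%N => shifted_sym j.+2 - e1 * shifted_sym j.+1 + e2 * shifted_sym j
  | 1%N => shifted_sym j.+1 - e1 * shifted_sym j
  | _ => shifted_sym j end.

Lemma expX_coef (b : 'I_3) j : 'X_b ^+ j = \sum_(c < 3) coef j c * 'X_b ^+ c.
Proof.
rewrite !big_ord_recl big_ord0 /= expr0 expr1 /bump /= addr0 mulr1.
have root : 'X_b ^+ 3 = e1 * 'X_b ^+ 2 - e2 * 'X_b + e3.
  suff : ('X_b - x 0) * ('X_b - x 1) * ('X_b - x 2) = 0.
    by move=> E; apply/subr0_eq; rewrite -[RHS]E /e1 /e2 /e3; ring.
  have : b \in [:: inord 0; inord 1; inord 2].
    by rewrite !inE -!val_eqE /= !inordK //; case: b => [[|[|[|//]]] ?].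
  by rewrite !inE => /or3P[] /eqP ->; rewrite -/(x _) subrr ?(mulr0, mul0r).
elim: j => [|j IH].
  by rewrite expr0 /shifted_sym /= complete_sym0; ring.
rewrite exprS IH shifted_sym_rec.
transitivity (shifted_sym j * 'X_b ^+ 3 + (shifted_sym j.+1 - e1 * shifted_sym j) * 'X_b ^+ 2
   + (shifted_sym j.+2 - e1 * shifted_sym j.+1 + e2 * shifted_sym j) * 'X_b).
  by ring.
by rewrite root; ring.
Qed.

(** By [expX_coef] the alternant matrix is the coefficient matrix times the Vandermonde matrix, and
    the determinant is multiplicative. *)
Lemma schurE J : schur F J = \det (\matrix_(a < 3, c < 3) coef (tnth J a) c).
Proof.
apply/esym/schurP; rewrite -det_mulmx; congr (\det _).
apply/matrixP => a b; rewrite !mxE expX_coef.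
by apply: eq_bigr => c _; rewrite !mxE.
Qed.

(** For the exponents 0, 1, [j] the coefficient matrix is lower triangular with diagonal 1, 1,
    h_{j-2}. *)
Lemma schur01 j : (1 < j)%N -> schur F [tuple 0; 1; j]%N = complete_sym 3 (j - 2).
Proof.
move=> j1; rewrite schurE det_trig.
  rewrite !big_ord_recl big_ord0 !mxE /= /shifted_sym /= j1 complete_sym0.
  by rewrite (tnth_nth 0%N) /=; ring.
apply/is_trig_mxP => a c; rewrite !mxE (tnth_nth 0%N).
case: a => [[|[|[|//]]] ?]; case: c => [[|[|[|//]]] ?] //= _;
  by rewrite /shifted_sym /= ?mulr0 ?subrr.
Qed.

Lemma schur_ideal_complete_sym i2 i3 i4 :
  (1 < i2)%N -> (1 < i3)%N -> (1 < i4)%N ->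
  schur_ideal F [:: 0; 1; i2; i3; i4]%N =
  ideal_gen [set` [:: complete_sym 3 (i2 - 2); complete_sym 3 (i3 - 2);
                      complete_sym 3 (i4 - 2)]].
Proof.
move=> i2_gt1 i3_gt1 i4_gt1; set h := [:: _; _; _].
apply/seteqP; split; apply: ideal_gen_subset.
  move=> _ [J sJ ->]; rewrite schurE (expand_det_col _ ord_max); apply: ideal_gen_sum => a _.
  apply: ideal_genMr; rewrite mxE /=.
  have := mem_subseq sJ (mem_tnth a J); rewrite /shifted_sym !inE.
  move=> /or4P[/eqP ->|/eqP ->|/eqP ->|/orP[] /eqP ->] //=;
    rewrite ?i2_gt1 ?i3_gt1 ?i4_gt1; try exact: ideal_gen0;
    by apply: ideal_gen_mem; rewrite /= !inE eqxx ?orbT.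
have sub j : (1 < j)%N -> j \in [:: i2; i3; i4] ->
    ideal_gen [set s | exists2 J : 3.-tuple nat, subseq J [:: 0; 1; i2; i3; i4]%N & s = schur F J]
      (complete_sym 3 (j - 2)).
  move=> j1 jI; apply: ideal_gen_mem; exists [tuple 0; 1; j]%N; last by rewrite schur01.
  have jS : subseq [:: j] [:: i2; i3; i4] by rewrite sub1seq.
  exact: (cat_subseq (subseq_refl [:: 0; 1]%N) jS).
by move=> p; rewrite /= !inE => /or3P[] /eqP ->; apply: sub => //; rewrite !inE eqxx ?orbT.
Qed.

End CompleteSym3.

Theorem mainTheorem5 (R : realType) (i2 i3 i4 : nat)
    (h12 : (1 < i2)%N) (h23 : (i2 < i3)%N) (h34 : (i3 < i4)%N) :
  let I := [:: 0; 1; i2; i3; i4]%N in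
  let h : seq {mpoly R[i][3]} :=
    [:: complete_sym 3 (i2 - 2); complete_sym 3 (i3 - 2); complete_sym 3 (i4 - 2)] in
  schur_ideal R[i] I = ideal_gen [set` h] /\
  (has_codim (Vd R[i] I) 3 <-> regular_sequence h).
Proof.
move=> I h.
have i3_gt : (2 < i3)%N := leq_ltn_trans h12 h23.
have i4_gt : (2 < i4)%N := ltn_trans i3_gt h34.
have idealE : schur_ideal R[i] I = ideal_gen [set` h].
  by apply: schur_ideal_complete_sym => //; apply: ltnW.
split=> //; rewrite /Vd idealE zero_locus_ideal_gen.
have [i2E|i2_neq] := eqVneq i2 2%N; last first.
  have i2_gt : (2 < i2)%N by rewrite ltn_neqAle eq_sym i2_neq.
  apply: (has_codim3_regular (@complex_uncountable R));
    by [exact: complete_sym_homog|rewrite subn_gt0].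
(* When [i2 = 2], the form h_0 = 1 makes both sides false: the zero set is empty, so it has no
   irreducible subset and no dimension, and the ideal is not proper. *)
have h1 : 1 \in h by rewrite inE i2E subnn complete_sym0 eqxx.
split=> [[d [[Z [HZ _]] _] _]|[_ []]]; last exact: ideal_gen_mem.
have [_ [[v Zv] _] /(_ v Zv) /(_ 1 h1)] := HZ 0%N isT.
by rewrite meval1 => /eqP; rewrite oner_eq0.
Qed.
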